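(* Let $k\ge 0$ be an integer and $\mathrm{R}\in\{\mathrm{J},\mathrm{S},\mathrm{AR}\}$. (i) If $\mathrm{R}=\mathrm{S}$ and $k=1$, or if $\mathrm{R}=\mathrm{AR}$ and $k\in\{0,1\}$, then every finite graph $G$ is determined up to isomorphism by $\mathcal{I}^k_{\mathrm{R}}(G)$, i.e. for finite graphs $G,G'$, $\mathcal{I}^k_{\mathrm{R}}(G)\cong\mathcal{I}^k_{\mathrm{R}}(G')$ implies $G\cong G'$. (ii) For every other pair $(\mathrm{R},k)$, there exist non-isomorphic finite graphs $G,G'$ with $\mathcal{I}^k_{\mathrm{R}}(G)\cong\mathcal{I}^k_{\mathrm{R}}(G')$.
   Context: All graphs are finite and simple; an independent set is a set of pairwise non-adjacent vertices. $\mathcal{I}^k_{\mathrm{J}}(G)$ (Token Jumping) has as vertices the independent sets of $G$ of size exactly $k$, with $I,J$ adjacent iff $I\setminus J=\{u\}$ and $J\setminus I=\{v\}$ for some vertices $u\neq v$. $\mathcal{I}^k_{\mathrm{S}}(G)$ (Token Sliding) has the same vertices, with $I,J$ adjacent iff $I\setminus J=\{u\}$, $J\setminus I=\{v\}$ and $uv\in E(G)$. $\mathcal{I}^k_{\mathrm{AR}}(G)$ (Token Addition and Removal) has as vertices the independent sets of $G$ of size at least $k$, with $I,J$ adjacent iff their symmetric difference has exactly one element. *)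

(* Defs.v *)
From mathcomp Require Import all_boot all_order.
Set Implicit Arguments. Unset Strict Implicit. Unset Printing Implicit Defensive.

Definition simple_graph (T : finType) (e : rel T) : Prop :=
  irreflexive e /\ symmetric e.

Definition graph_iso (V V' : finType) (r : rel V) (r' : rel V') : Prop :=
  exists f : V -> V', bijective f /\ forall x y, r' (f x) (f y) = r x y.

Definition independent (T : finType) (e : rel T) (I : {set T}) : bool :=
  [forall x in I, forall y in I, ~~ e x y].

(* Reconfiguration rules: Token Jumping, Token Sliding, Token Addition/Removal *)
Inductive rule := TJ | TS | TAR.

Definition rvert_pred (T : finType) (R : rule) (k : nat) (e : rel T)
  (I : {set T}) : bool :=
  independent e I && (if R is TAR then k <= #|I| else #|I| == k).

Definition radj_sets (T : finType) (R : rule) (e : rel T) (I J : {set T}) : bool :=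
  match R with
  | TJ => (#|I :\: J| == 1) && (#|J :\: I| == 1)
  | TS => [exists u, exists v,
             [&& I :\: J == [set u], J :\: I == [set v] & e u v]]
  | TAR => #|(I :\: J) :|: (J :\: I)| == 1
  end.

Definition rvert (T : finType) (R : rule) (k : nat) (e : rel T) : finType :=
  {I : {set T} | rvert_pred R k e I}.

Definition reconf_graph (T : finType) (R : rule) (k : nat) (e : rel T)
  : rel (rvert R k e) :=
  fun I J => radj_sets R e (val I) (val J).

Arguments rvert {T} R k e.
Arguments reconf_graph {T} R k e.
Arguments rvert_pred {T} R k e.
Arguments radj_sets {T} R e.

(* Main.v *)
Require Import Defs.
From mathcomp Require Import all_boot all_order.
(** Negative part: two complete graphs have no independent sets of size [k >= 2],
    the empty set is the only one of size 0, and Token Jumping with [k = 1]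
    always gives a complete graph.

    Positive part for TAR: the reconfiguration graph is a union of cubes [[I, J]].
    For [k = 0], a vertex of full degree is a set of isolated vertices, so the
    image of [set0] can be translated back to [set0]; then non-adjacency of
    [v, w] says that [{v}], [{w}] have two common neighbours.  For [k = 1], [set0] is
    missing, but it is detected by 3-cubes lacking a corner, so an isomorphism
    sends [{v}] to a singleton as soon as [v] lies in an independent triple, and
    then for all of the component of [v] in the complement of the graph.  On the
    remaining components singletons and pairs may be exchanged, but these are
    cycles of the complement, which are isomorphic to their line graphs. *)
Set Implicit Arguments. Unset Strict Implicit. Unset Printing Implicit Defensive.

(** * Flips and adjacency in the cube of all vertex sets *)

(** Symmetric difference with [[set x]], written as a boolean xor so that flips visibly cancel and
    commute. *)
Definition flip (T : finType) (I : {set T}) (x : T) : {set T} :=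
  [set y | (y \in I) (+) (y == x)].

(** Convertible to [radj_sets TAR e], which does not depend on [e]. *)
Definition adj (T : finType) (I J : {set T}) : bool :=
  #|(I :\: J) :|: (J :\: I)| == 1.

Lemma in_flip (T : finType) (I : {set T}) x y :
  (y \in flip I x) = (y \in I) (+) (y == x).
Proof. by rewrite inE. Qed.

Lemma flipK (T : finType) (x : T) : involutive (fun I => flip I x).
Proof. by move=> I; apply/setP=> y; rewrite !in_flip addbK. Qed.

Lemma flipC (T : finType) (I : {set T}) x y : flip (flip I x) y = flip (flip I y) x.
Proof. by apply/setP=> z; rewrite !in_flip addbAC. Qed.

Lemma flip_inj (T : finType) (I : {set T}) : injective (flip I).
Proof.
move=> x y /setP/(_ x); rewrite !in_flip eqxx.
by case: eqVneq => // _; case: (x \in I).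
Qed.

Lemma flip0 (T : finType) (x : T) : flip set0 x = [set x].
Proof. by apply/setP=> y; rewrite in_flip !inE. Qed.

Lemma flip1 (T : finType) (x y : T) : x != y -> flip [set x] y = [set x; y].
Proof.
move=> xy; apply/setP=> z; rewrite in_flip !inE.
by case: (eqVneq z x) => [->|//]; rewrite (negPf xy).
Qed.

Lemma adjP (T : finType) (I J : {set T}) :
  reflect (exists x, J = flip I x) (adj I J).
Proof.
apply: (iffP cards1P) => [[x E]|[x ->]]; exists x; apply/setP=> y.
  move/setP/(_ y): E; rewrite !inE.
  by case: (y \in I); case: (y \in J); case: (y == x).
by rewrite !inE; case: (y \in I); case: (y == x).
Qed.

Lemma adj_flip (T : finType) (I : {set T}) x : adj I (flip I x).
Proof. by apply/adjP; exists x. Qed.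

Lemma adj_sym (T : finType) (I J : {set T}) : adj I J = adj J I.
Proof. by rewrite /adj setUC. Qed.

(** Vertices at distance 2 in a cube have just two common neighbours: membership of [x] in [K]
    forces [x] to be flipped on exactly one of the two routes. *)
Lemma adj_flip_flip (T : finType) (I K : {set T}) x y : x != y ->
  adj (flip I x) K -> adj (flip I y) K -> K = I \/ K = flip (flip I x) y.
Proof.
move=> xy /adjP[a ->] /adjP[b /setP E].
have := E x; rewrite !in_flip eqxx (negPf xy) !addbF.
case: (eqVneq x a) => [<- _|xa]; first by left; rewrite flipK.
case: (eqVneq x b) => [xb _|xb]; last by case: (x \in I).
by right; apply/setP=> z; rewrite E -xb flipC.
Qed.

Lemma adj_card (T : finType) (I J : {set T}) : adj I J -> odd #|J| = ~~ odd #|I|.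
Proof.
case/adjP=> x ->; case: (boolP (x \in I)) => xI.
  have ->: flip I x = I :\ x.
    apply/setP=> y; rewrite in_flip !inE.
    by case: eqVneq => [->|_]; rewrite ?xI ?addbF.
  by rewrite (cardsD1 x I) xI /= negbK.
have ->: flip I x = x |: I.
  apply/setP=> y; rewrite in_flip !inE.
  by case: eqVneq => [->|_]; rewrite ?(negPf xI) ?addbF.
by rewrite cardsU1 xI.
Qed.

(** * Independent sets *)

Lemma independentP (T : finType) (e : rel T) (I : {set T}) :
  reflect (forall x y, x \in I -> y \in I -> ~~ e x y) (independent e I).
Proof.
apply: (iffP forall_inP) => [H x y xI yI|H x xI]; first by apply: (forall_inP (H x xI)).
by apply/forall_inP=> y; apply: H.
Qed.

Lemma independent_sub (T : finType) (e : rel T) (I J : {set T}) :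
  J \subset I -> independent e I -> independent e J.
Proof.
move=> /subsetP JI /independentP H; apply/independentP=> x y /JI xI /JI yI.
exact: H.
Qed.

Lemma independent1 (T : finType) (e : rel T) x :
  simple_graph e -> independent e [set x].
Proof. by move=> [irr _]; apply/independentP=> y z /set1P-> /set1P->; rewrite irr. Qed.

Lemma independent2 (T : finType) (e : rel T) x y :
  simple_graph e -> independent e [set x; y] = ~~ e x y.
Proof.
move=> [irr sym]; apply/independentP/idP => [|nexy]; first by apply; rewrite !inE eqxx ?orbT.
by move=> a b /set2P[]-> /set2P[]->; rewrite ?irr // sym.
Qed.

(** * Isomorphisms of TAR graphs as maps on sets *)

(** One half of an isomorphism. Total functions on sets, constrained only on valid sets, avoid the
    sigma type; [tar_iso] pairs two halves so that it is symmetric. *)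
Definition tar_map (k : nat) (T T' : finType) (e : rel T) (e' : rel T')
    (f : {set T} -> {set T'}) (g : {set T'} -> {set T}) : Prop :=
  [/\ forall I, rvert_pred TAR k e I -> rvert_pred TAR k e' (f I),
      forall I, rvert_pred TAR k e I -> g (f I) = I
    & forall I J, rvert_pred TAR k e I -> rvert_pred TAR k e J ->
        adj (f I) (f J) = adj I J].

Definition tar_iso (k : nat) (T T' : finType) (e : rel T) (e' : rel T') f g : Prop :=
  tar_map k e e' f g /\ tar_map k e' e g f.

Lemma tar_iso_sym k (T T' : finType) (e : rel T) (e' : rel T') f g :
  tar_iso k e e' f g -> tar_iso k e' e g f.
Proof. by case. Qed.

Lemma graph_iso_tar k (T T' : finType) (e : rel T) (e' : rel T') :
  graph_iso (reconf_graph TAR k e) (reconf_graph TAR k e') ->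
  exists f g, tar_iso k e e' f g.
Proof.
move=> [F [[G FK GK] Fadj]].
exists (fun I => if insub I is Some u then val (F u) else set0).
exists (fun I => if insub I is Some u then val (G u) else set0).
split; split=> [I PI|I PI|I J PI PJ].
- by rewrite insubT; apply: valP.
- by rewrite (insubT _ PI) valK FK.
- by rewrite !insubT; apply: Fadj.
- by rewrite insubT; apply: valP.
- by rewrite (insubT _ PI) valK GK.
rewrite !insubT.
have := Fadj (G (exist _ I PI)) (G (exist _ J PJ)).
rewrite !GK => /esym E; exact: E.
Qed.

(** * Embeddings, and orientations of 2-regular graphs *)

Definition embeds (T T' : finType) (e : rel T) (e' : rel T') : Prop :=
  exists h : T -> T', injective h /\ forall x y, e' (h x) (h y) = e x y.

Lemma embeds_iso (T T' : finType) (e : rel T) (e' : rel T') :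
  embeds e e' -> #|T'| <= #|T| -> graph_iso e e'.
Proof. by move=> [h [hI hE]] le; exists h; split=> //; apply: inj_card_bij. Qed.

(* Orientation of a disjoint union of cycles: walking along a cycle permutes
   the darts, and no walk ends on the reverse of its first dart. *)
Lemma orient_2regular (T : finType) (r : rel T) :
  irreflexive r -> symmetric r ->
  (forall u v, r u v -> exists2 w, w != u & forall z, r v z = (z == u) || (z == w)) ->
  exists A : rel T,
    [/\ forall u v, A u v -> r u v,
        forall u v, r u v -> A u v = ~~ A v u,
        forall u v, r u v -> exists w, A u w,
        forall u v w, A u v -> A u w -> v = w
      & forall u v w, A v u -> A w u -> v = w].
Proof.
move=> irr sym H.
(* A dart [(u, v)] moves on to [(v, w)], with [w] the other neighbour of [v]; pairs that are not
   edges stay fixed, which keeps [next] injective everywhere. *)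
pose next (d : T * T) := if [pick w | r d.1 d.2 && r d.2 w && (w != d.1)] is Some w
                 then (d.2, w) else d.
have nextP u v : r u v -> exists w, [/\ next (u, v) = (v, w), w != u, r v w
    & forall z, r v z = (z == u) || (z == w)].
  move=> ruv; have [w wu Hw] := H _ _ ruv; exists w.
  rewrite Hw eqxx orbT; split=> //; rewrite /next; case: pickP => /= [z|/(_ w)].
    by rewrite Hw ruv => /andP[/orP[]/eqP-> //]; rewrite eqxx.
  by rewrite ruv Hw eqxx wu orbT.
have nextN u v : ~~ r u v -> next (u, v) = (u, v).
  by move=> nr; rewrite /next; case: pickP => //= w; rewrite (negPf nr).
pose rev (d : T * T) := (d.2, d.1).
have revK d : rev (rev d) = d by case: d.
(* Reversal conjugates [next] to its inverse. *)
have next_rev d : next (rev (next d)) = rev d.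
  case: d => u v; case: (boolP (r u v)) => [ruv|nr]; last first.
    by rewrite nextN // /rev /= nextN // sym.
  have [w [-> wu rvw Hw]] := nextP _ _ ruv; rewrite /rev /=.
  have [|x [-> xw rvx _]] := nextP w v; first by rewrite sym.
  by move: rvx; rewrite Hw (negPf xw) orbF => /eqP->.
have nextI : injective next.
  move=> c d E; apply: (can_inj revK).
  by rewrite -(next_rev c) E next_rev.
(* Cancelling the first and the last step of a walk from a dart to its reverse leaves such a walk
   from [(v, w)], two steps shorter. *)
have nrev n u v : r u v -> iter n next (u, v) != rev (u, v).
  elim/ltn_ind: n u v => -[|[|n]] IH u v ruv.
  - by apply/eqP=> -[E _]; rewrite E irr in ruv.
  - have [w [/= -> wu _ _]] := nextP _ _ ruv.
    by apply/eqP=> -[E]; rewrite E eqxx in wu.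
  have [w [E _ rvw _]] := nextP _ _ ruv.
  rewrite -next_rev iterS (inj_eq nextI) iterSr E; exact: IH.
have csym := fconnect_sym nextI.
(* [rk] numbers the orbits of [next]. A dart and its reverse lie in different orbits, so comparing
   their ranks picks one direction for each cycle. *)
pose rk d : nat := enum_rank (root (frel next) d).
have rkE c d : (rk c == rk d) = fconnect next c d.
  by rewrite /rk val_eqE (inj_eq enum_rank_inj) root_connect.
have rk_next d : rk (next d) = rk d.
  by apply/eqP; rewrite rkE csym fconnect1.
have rk_rev d : rk (rev (next d)) = rk (rev d) by rewrite -rk_next next_rev.
pose A u v := r u v && (rk (u, v) < rk (v, u)).
have Ar u v : A u v -> r u v by case/andP.
have AN u v : r u v -> A u v = ~~ A v u.
  move=> ruv; rewrite /A ruv sym ruv /= -leqNgt ltn_neqAle rkE.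
  case: (boolP (fconnect _ _ _)) => //= /iter_findex E.
  by have := nrev (findex next (u, v) (v, u)) _ _ ruv; rewrite E eqxx.
have Anext u v w : r u v -> next (u, v) = (v, w) -> A u v = A v w.
  move=> ruv E; have rvw : r v w by have [x [+ _ ? _]] := nextP _ _ ruv; rewrite E => -[->].
  by rewrite /A ruv rvw -(rk_next (u, v)) -(rk_rev (u, v)) E.
exists A; split=> //.
- move=> u v ruv; case: (boolP (A u v)) => [Auv|]; first by exists v.
  have rvu : r v u by rewrite sym.
  rewrite AN // negbK => Avu.
  have [w [E _ _ _]] := nextP _ _ rvu; exists w.
  by rewrite -(Anext _ _ _ rvu E).
- move=> u v w Auv Auw; apply/eqP; apply/contraTT: Auw => vw.
  have rvu : r v u by rewrite sym Ar.
  have [x [E xv rux Hx]] := nextP _ _ rvu.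
  apply/negP=> Auw; have := Ar _ _ Auw; rewrite Hx eq_sym (negPf vw) /= => /eqP wx.
  by move: Auw; rewrite wx -(Anext _ _ _ rvu E) AN // Auv.
move=> u v w Avu Awu; apply/eqP; apply/contraTT: Awu => vw.
have [x [E xv rux Hx]] := nextP _ _ (Ar _ _ Avu).
apply/negP=> Awu; have := Ar _ _ Awu; rewrite sym Hx eq_sym (negPf vw) /= => /eqP wx.
have := Anext _ _ _ (Ar _ _ Avu) E; rewrite Avu -wx => /esym Auw.
by have := AN _ _ (Ar _ _ Auw); rewrite Auw Awu.
Qed.

(** * Token Addition and Removal with [k = 0] *)

Lemma valid0E (T : finType) (e : rel T) I : rvert_pred TAR 0 e I = independent e I.
Proof. by rewrite /rvert_pred andbT. Qed.

Lemma valid1E (T : finType) (e : rel T) I :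
  rvert_pred TAR 1 e I = independent e I && (I != set0).
Proof. by rewrite /rvert_pred card_gt0. Qed.

Lemma tar_map_inj k (T T' : finType) (e : rel T) (e' : rel T') f g I J :
  tar_map k e e' f g -> rvert_pred TAR k e I -> rvert_pred TAR k e J ->
  f I = f J -> I = J.
Proof. by move=> [_ fK _] VI VJ E; rewrite -[I]fK // E fK. Qed.

(** Singletons are neighbours of [set0], so their images are flips of [f set0], a set that need not
    be empty. *)
Lemma tar0_shift (T T' : finType) (e : rel T) (e' : rel T') f g :
  simple_graph e -> tar_iso 0 e e' f g ->
  exists2 h : T -> T', injective h & forall v, f [set v] = flip (f set0) (h v).
Proof.
move=> se [fM _]; have [_ _ fA] := fM.
have V0 : rvert_pred TAR 0 e set0.
  by rewrite valid0E; apply/independentP=> x y; rewrite inE.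
have V1 v : rvert_pred TAR 0 e [set v] by rewrite valid0E independent1.
have /fin_all_exists[h hP] : forall v, exists x, f [set v] = flip (f set0) x.
  by move=> v; apply/adjP; rewrite fA // -flip0 adj_flip.
exists h => // v w E; apply: set1_inj; apply: (tar_map_inj fM) => //.
by rewrite !hP E.
Qed.

Lemma tar0_embeds (T T' : finType) (e : rel T) (e' : rel T') f g :
  simple_graph e -> simple_graph e' -> tar_iso 0 e e' f g -> embeds e e'.
Proof.
move=> se se' iso; have [h hI hP] := tar0_shift se iso.
have [h' h'I _] := tar0_shift se' (tar_iso_sym iso).
(* Injections both ways make [h] bijective, so every flip of [t] is the image of a singleton and
   hence independent. *)
have [h1 _ hK] : bijective h by apply: inj_card_bij => //; apply: leq_card h'I.
have [fM [gV gK gA]] := iso; have [fV fK fA] := fM.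
have V1 v : rvert_pred TAR 0 e [set v] by rewrite valid0E independent1.
have V0 : rvert_pred TAR 0 e set0.
  by rewrite valid0E; apply/independentP=> x y; rewrite inE.
set t := f set0 in hP; have Vt : independent e' t by rewrite -valid0E fV.
have Vflip x : independent e' (flip t x) by rewrite -[x]hK -hP -valid0E fV.
(* [f set0] has full degree, hence consists of isolated vertices. *)
have isol x y : x \in t -> ~~ e' x y.
  move=> xt; case: (boolP (y \in t)) => yt; first exact: (independentP _ _ Vt).
  apply: (independentP _ _ (Vflip y)); rewrite in_flip ?eqxx ?(negPf yt) // xt.
  by case: eqVneq => // xy; rewrite -xy xt in yt.
exists h; split=> // v w; case: (eqVneq v w) => [<-|vw].
  by rewrite (proj1 se) (proj1 se').
have hvw : h v != h w by rewrite (inj_eq hI).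
apply/idP/idP; apply: contraTT.
  (* The image of [[set v; w]] is a common neighbour of two flips of [t] and differs from [t], so it
     is the double flip. *)
  move=> nevw; have VK : rvert_pred TAR 0 e [set v; w] by rewrite valid0E independent2.
  have : adj (f [set v]) (f [set v; w]) by rewrite fA // -flip1 // adj_flip.
  have : adj (f [set w]) (f [set v; w]).
    by rewrite fA // setUC -flip1 1?eq_sym // adj_flip.
  rewrite !hP => Aw Av; have [/(tar_map_inj fM VK V0)/setP/(_ v)|E] := adj_flip_flip hvw Av Aw.
    by rewrite !inE eqxx.
  case: (boolP (h v \in t)) => [|hv]; first exact: isol.
  case: (boolP (h w \in t)) => [|hw]; first by rewrite (proj2 se'); exact: isol.
  have /independentP : independent e' (f [set v; w]) by rewrite -valid0E fV.
  rewrite E; apply; rewrite !in_flip eqxx ?(negPf hv) ?(negPf hw).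
    by rewrite (negPf hvw).
  by rewrite eq_sym (negPf hvw).
(* Conversely the double flip [K] is independent, since [t] consists of isolated vertices, and [g K]
   can only be [[set v; w]]. *)
move=> ne; pose K := flip (flip t (h v)) (h w).
have VK : rvert_pred TAR 0 e' K.
  rewrite valid0E; apply/independentP=> x y.
  case: (boolP (x \in t)) => [xt _ _|xt]; first exact: isol.
  case: (boolP (y \in t)) => [yt _ _|yt]; first by rewrite (proj2 se'); exact: isol.
  have inK z : z \notin t -> z \in K -> z \in [set h v; h w].
    move=> /negPf zt; rewrite !in_flip zt !inE /=.
    by case: eqVneq.
  move=> /(inK _ xt) xK /(inK _ yt) yK.
  by apply: (independentP _ [set h v; h w] _) => //; rewrite independent2.
have : adj (g (f [set v])) (g K) by rewrite gA ?fV // hP adj_flip.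
have : adj (g (f [set w])) (g K) by rewrite gA ?fV // hP /K flipC adj_flip.
rewrite !fK // -!flip0 => Aw Av.
have [E|E] := adj_flip_flip vw Av Aw; last first.
  by have := gV _ VK; rewrite valid0E E flip0 flip1 // independent2.
have : K = t by rewrite -(gK _ VK) E.
rewrite /K -[RHS](flipK (h v)) => /flip_inj E'.
by rewrite E' eqxx in hvw.
Qed.

(** * Token Addition and Removal with [k = 1] *)

(** The triangle is one of the complement graph. *)
Definition in_triangle (T : finType) (e : rel T) (v : T) : Prop :=
  exists a b, [/\ v != a, v != b, a != b & independent e [set v; a; b]].

Lemma valid_set1 (T : finType) (e : rel T) v :
  simple_graph e -> rvert_pred TAR 1 e [set v].
Proof. by move=> se; rewrite valid1E independent1 // -cards_eq0 cards1. Qed.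

Lemma valid_set2 (T : finType) (e : rel T) v w :
  simple_graph e -> rvert_pred TAR 1 e [set v; w] = ~~ e v w.
Proof.
move=> se; rewrite valid1E independent2 // andb_idr // => _.
by apply/set0Pn; exists v; rewrite !inE eqxx.
Qed.

Lemma adj_set1_set2 (T : finType) (v w : T) : v != w -> adj [set v] [set v; w].
Proof. by move=> vw; rewrite -flip1 // adj_flip. Qed.

Lemma set2_injr (T : finType) (v a b : T) : v != a -> [set v; a] = [set v; b] -> a = b.
Proof.
move=> va /setP/(_ a); rewrite !inE eqxx orbT eq_sym (negPf va).
by move/esym/eqP.
Qed.

Lemma set1_neq2 (T : finType) (x v w : T) : v != w -> [set x] <> [set v; w].
Proof. by move=> vw /(congr1 (fun A : {set T} => #|A|)); rewrite cards1 cards2 vw. Qed.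

(** The other common neighbour in the cube is [set0], which is not valid for [k = 1]. *)
Lemma adj_singletonsP (T : finType) (e : rel T) (v w : T) K :
  v != w -> rvert_pred TAR 1 e K -> adj [set v] K -> adj [set w] K -> K = [set v; w].
Proof.
rewrite valid1E => vw /andP[_ K0]; rewrite -!flip0 => Av Aw.
have [E|->] := adj_flip_flip vw Av Aw; first by rewrite E eqxx in K0.
by rewrite !flip0 flip1.
Qed.

Lemma adj_set1 (T : finType) (e : rel T) v K :
  rvert_pred TAR 1 e K -> adj [set v] K -> exists2 w, v != w & K = [set v; w].
Proof.
rewrite valid1E => /andP[_ K0] /adjP[w KE].
have vw : v != w by apply: contraNneq K0 => vw; rewrite KE -flip0 vw flipK.
by exists w; rewrite // KE flip1.
Qed.

Lemma adj_set2 (T : finType) (e : rel T) v w K :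
  v != w -> rvert_pred TAR 1 e K -> adj [set v; w] K ->
  [\/ K = [set v], K = [set w] | in_triangle e v /\ in_triangle e w].
Proof.
rewrite valid1E => vw /andP[iK _] /adjP[z KE].
case: (eqVneq z w) => [zw|zw].
  by apply: Or31; rewrite KE -flip1 // zw flipK.
case: (eqVneq z v) => [zv|zv].
  by apply: Or32; rewrite KE zv setUC -flip1 1?eq_sym // flipK.
have KE' : K = [set v; w; z].
  apply/setP=> y; rewrite KE in_flip !inE.
  by case: (eqVneq y z) => [->|]; rewrite ?(negPf zw) ?(negPf zv) ?orbF ?addbF.
apply: Or33; split; [exists w, z|exists v, z]; split; rewrite // 1?eq_sym //.
  by rewrite -KE'.
by rewrite [[set w; v]]setUC -KE'.
Qed.

(* The cube below [{v, a, b}] lacks its corner [set0]. Any three squares around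
   a common vertex of [e'] span a cube of independent sets, so the missing
   corner of the image must be [set0] as well. *)
Lemma triangle_singleton (T T' : finType) (e : rel T) (e' : rel T') f g v :
  simple_graph e -> tar_iso 1 e e' f g -> in_triangle e v ->
  exists x, f [set v] = [set x].
Proof.
move=> se [fM [gV gK gA]] [a [b [va vb ab it]]]; have [fV fK fA] := fM.
have VS (J : {set T}) : J \subset [set v; a; b] -> J != set0 -> rvert_pred TAR 1 e J.
  by move=> sJ J0; rewrite valid1E J0 (independent_sub sJ).
have V1 x : rvert_pred TAR 1 e [set x] by apply: valid_set1.
have Vt : rvert_pred TAR 1 e [set v; a; b].
  by apply: VS => //; apply/set0Pn; exists v; rewrite !inE eqxx.
have V2 x y : x \in [set v; a; b] -> y \in [set v; a; b] -> rvert_pred TAR 1 e [set x; y].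
  move=> xt yt; apply: VS; first by rewrite subUset !sub1set xt.
  by apply/set0Pn; exists x; rewrite !inE eqxx.
have inv : v \in [set v; a; b] by rewrite !inE eqxx.
have ina : a \in [set v; a; b] by rewrite !inE eqxx orbT.
have inb : b \in [set v; a; b] by rewrite !inE eqxx orbT.
have Ad x y z : [set v; a; b] = [set x; y; z] -> x != z -> y != z ->
    adj [set v; a; b] [set x; y].
  move=> -> xz yz; rewrite adj_sym; apply/adjP; exists z; apply/setP=> w.
  rewrite in_flip !inE; case: (eqVneq w z) => [->|]; last by rewrite orbF addbF.
  by rewrite ![z == _]eq_sym (negPf xz) (negPf yz).
have Avab : [set v; a; b] = [set v; b; a] by rewrite setUAC.
have Aabv : [set v; a; b] = [set a; b; v] by rewrite -setUA setUC.
have /adjP[x1 E1] : adj (f [set v; a; b]) (f [set v; a]) by rewrite fA ?V2 // (Ad _ _ b).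
have /adjP[x2 E2] : adj (f [set v; a; b]) (f [set v; b]).
  by rewrite fA ?V2 // (Ad _ _ a) // eq_sym.
have /adjP[x3 E3] : adj (f [set v; a; b]) (f [set a; b]).
  by rewrite fA ?V2 // (Ad _ _ v) // eq_sym.
set t := f [set v; a; b] in E1 E2 E3.
have inj (J K : {set T}) : rvert_pred TAR 1 e J -> rvert_pred TAR 1 e K -> J <> K -> f J <> f K.
  by move=> VJ VK JK /(tar_map_inj fM VJ VK).
have x12 : x1 != x2.
  apply/eqP=> E; apply: (inj [set v; a] [set v; b]); rewrite ?V2 // ?E1 ?E2 ?E //.
  by move/(set2_injr va)/eqP; rewrite (negPf ab).
have x13 : x1 != x3.
  apply/eqP=> E; apply: (inj [set v; a] [set a; b]); rewrite ?V2 // ?E1 ?E3 ?E //.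
  by rewrite setUC eq_sym in va *; move/(set2_injr va)/eqP; rewrite (negPf vb).
have x23 : x2 != x3.
  apply/eqP=> E; apply: (inj [set v; b] [set a; b]); rewrite ?V2 // ?E2 ?E3 ?E //.
  rewrite ![[set _; b]]setUC => /set2_injr; rewrite eq_sym => /(_ vb)/eqP.
  by rewrite (negPf va).
(* The singleton and the triple are the two common neighbours of the pairs [[set u; y]] and
   [[set u; z]]. *)
have corner u y z xi xj : u \in [set v; a; b] -> y \in [set v; a; b] -> z \in [set v; a; b] ->
    u != y -> u != z -> y != z ->
    f [set u; y] = flip t xi -> f [set u; z] = flip t xj -> xi != xj ->
    f [set u] = flip (flip t xi) xj.
  move=> ut yt zt uy uz yz Ei Ej xij.
  have : adj (f [set u; y]) (f [set u]) by rewrite fA ?V2 // adj_sym adj_set1_set2.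
  have : adj (f [set u; z]) (f [set u]) by rewrite fA ?V2 // adj_sym adj_set1_set2.
  rewrite Ei Ej => Aj Ai; have [/esym E|//] := adj_flip_flip xij Ai Aj.
  case: (inj _ _ Vt (V1 u) _ E) => E'.
  by move: zt; rewrite E' => /set1P zu; rewrite zu eqxx in uz.
have Ev : f [set v] = flip (flip t x1) x2 by apply: (corner v a b).
have Ea : f [set a] = flip (flip t x1) x3.
  by apply: (corner a v b) => //; [rewrite eq_sym|rewrite setUC].
have Eb : f [set b] = flip (flip t x2) x3.
  by apply: (corner b v a) => //; [rewrite eq_sym|rewrite eq_sym|rewrite setUC|rewrite setUC].
(* The corner opposite to [t] in the image cube. *)
pose q := flip (flip (flip t x1) x2) x3.
have Eqv : q = flip (f [set v]) x3 by rewrite Ev.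
have Eqa : q = flip (f [set a]) x2 by rewrite Ea flipC.
have Eqb : q = flip (f [set b]) x1 by rewrite Eb /q [flip (flip t x1) x2]flipC flipC.
(* Two elements of [q] cannot cover all of [x1], [x2], [x3]. Both therefore lie in an independent
   set differing from [q] only by a missed [xi]. *)
have iq : independent e' q.
  have iv u : independent e' (f [set u]) by have := fV _ (V1 u); rewrite valid1E => /andP[].
  have keep c x y z : q = flip (f [set c]) x -> y \in q -> z \in q -> y != x -> z != x ->
      ~~ e' y z.
    move=> ->; rewrite !in_flip => yq zq yx zx.
    by apply: (independentP _ _ (iv c)); [move: yq|move: zq];
      rewrite ?(negPf yx) ?(negPf zx) addbF.
  apply/independentP=> y z yq zq.
  case: (boolP ((y != x3) && (z != x3))) => [/andP[]|n3]; first exact: (keep v).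
  case: (boolP ((y != x2) && (z != x2))) => [/andP[]|n2]; first exact: (keep a).
  apply: (keep b _ _ _ Eqb) => //; apply/eqP=> E; move: n3 n2; rewrite E x12 x13 /=;
    rewrite ?andbT !negbK => /eqP-> /eqP E'; by rewrite E' eqxx in x23.
(* If [q] were valid, [g q] would be adjacent to all three singletons and so equal both [[set v; a]]
   and [[set v; b]]. *)
case: (eqVneq q set0) => [q0|q0].
  by exists x3; rewrite -[RHS]flip0 -q0 Eqv flipK.
have Vq : rvert_pred TAR 1 e' q by rewrite valid1E iq.
have Aq u x : q = flip (f [set u]) x -> adj [set u] (g q).
  move=> E; rewrite -{1}(fK _ (V1 u)) gA ?fV //; apply/adjP; by exists x.
have := adj_singletonsP vb (gV _ Vq) (Aq _ _ Eqv) (Aq _ _ Eqb).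
rewrite (adj_singletonsP va (gV _ Vq) (Aq _ _ Eqv) (Aq _ _ Eqa)).
by move/(set2_injr va)/eqP; rewrite (negPf ab).
Qed.

(** The neighbours of [[set v]] are pairs, as [set0] is missing, so the corner of the square
    opposite to it is a triple containing [v]. *)
Lemma square_in_triangle (T : finType) (e : rel T) v P Q K :
  rvert_pred TAR 1 e P -> rvert_pred TAR 1 e Q -> rvert_pred TAR 1 e K ->
  adj [set v] P -> adj [set v] Q -> P != Q -> adj P K -> adj Q K -> K != [set v] ->
  in_triangle e v.
Proof.
move=> VP VQ VK Pv Qv PQ PK QK Kv.
have [a va EP] := adj_set1 VP Pv; have [b vb EQ] := adj_set1 VQ Qv.
have ab : a != b by apply: contraNneq PQ => E; rewrite EP EQ E.
move: PK QK; rewrite EP EQ -!flip1 // => PK QK.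
have [E|E] := adj_flip_flip ab PK QK; first by rewrite E eqxx in Kv.
exists a, b; split=> //; move: VK; rewrite valid1E => /andP[+ _].
apply: independent_sub; apply/subsetP=> y; rewrite E !in_flip !inE.
case: (eqVneq y v) => [->|_]; rewrite ?(negPf va) ?(negPf vb) //=.
by case: (eqVneq y a) => [->|_]; rewrite ?(negPf ab).
Qed.

(** Being sent to a singleton spreads along edges of the complement. With [f [set v; w] =
    [set x; y]], the neighbour [g [set y]] of [[set v; w]] is either [[set w]] or a triple; in the
    latter case [w] lies in a triangle. *)
Lemma singleton_step (T T' : finType) (e : rel T) (e' : rel T') f g v w x :
  simple_graph e -> simple_graph e' -> tar_iso 1 e e' f g ->
  f [set v] = [set x] -> v != w -> ~~ e v w -> exists y, f [set w] = [set y].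
Proof.
move=> se se' iso fv vw nvw; have [fM [gV gK gA]] := iso; have [fV fK fA] := fM.
have V1 u : rvert_pred TAR 1 e [set u] by apply: valid_set1.
have V2 : rvert_pred TAR 1 e [set v; w] by rewrite valid_set2.
have [|y xy fvw] := adj_set1 (v := x) (fV _ V2); first by rewrite -fv fA // adj_set1_set2.
have Vy : rvert_pred TAR 1 e' [set y] by apply: valid_set1.
have : adj [set v; w] (g [set y]).
  by rewrite -(fK _ V2) gA ?fV // fvw adj_sym setUC adj_set1_set2 // eq_sym.
case/(adj_set2 vw (gV _ Vy)) => [E|E|[_ tw]].
- by move: (gK _ Vy) xy; rewrite E fv => /set1_inj ->; rewrite eqxx.
- by exists y; rewrite -E gK.
exact: (triangle_singleton se iso tw).
Qed.

(** If the image had three elements, dropping [x], [y] or both would keep [z], giving a square of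
    valid sets; pulled back, it puts [v] in a triangle. *)
Lemma nonsingleton_pair (T T' : finType) (e : rel T) (e' : rel T') f g v :
  simple_graph e -> tar_iso 1 e e' f g -> (forall x, f [set v] <> [set x]) ->
  exists x y, x != y /\ f [set v] = [set x; y].
Proof.
move=> se iso nfv; have [fM [gV gK gA]] := iso; have [fV fK fA] := fM.
have V1 : rvert_pred TAR 1 e [set v] by apply: valid_set1.
have := fV _ V1; rewrite valid1E => /andP[iJ /set0Pn[x xJ]].
case: (set_0Vmem (f [set v] :\ x)) => [E|[y]].
  by case: (nfv x); rewrite -(setD1K xJ) E setU0.
rewrite !inE => /andP[yx yJ].
case: (set_0Vmem (f [set v] :\: [set x; y])) => [/eqP|[z]].
  rewrite setD_eq0 => sJ; exists x, y; split; first by rewrite eq_sym.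
  by apply/eqP; rewrite eqEsubset sJ subUset !sub1set xJ.
rewrite !inE negb_or => /andP[/andP[zx zy] zJ].
suff /(triangle_singleton se iso)[u /nfv[]] : in_triangle e v.
set J := f [set v] in iJ xJ yJ zJ nfv.
have VJ (K : {set T'}) : K \subset J -> z \in K -> rvert_pred TAR 1 e' K.
  move=> sK zK; rewrite valid1E (independent_sub sK) //=.
  by apply/set0Pn; exists z.
have Vx : rvert_pred TAR 1 e' (flip J x).
  apply: VJ; last by rewrite in_flip zJ (negPf zx).
  by apply/subsetP=> u; rewrite in_flip; case: (eqVneq u x) => [->|]; rewrite ?xJ ?addbF.
have Vy : rvert_pred TAR 1 e' (flip J y).
  apply: VJ; last by rewrite in_flip zJ (negPf zy).
  by apply/subsetP=> u; rewrite in_flip; case: (eqVneq u y) => [->|]; rewrite ?yJ ?addbF.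
have Vxy : rvert_pred TAR 1 e' (flip (flip J x) y).
  apply: VJ; last by rewrite !in_flip zJ (negPf zx) (negPf zy).
  apply/subsetP=> u; rewrite !in_flip.
  case: (eqVneq u x) => [->|_]; rewrite ?xJ //.
  by case: (eqVneq u y) => [->|_]; rewrite ?yJ ?addbF.
have gI K L : rvert_pred TAR 1 e' K -> rvert_pred TAR 1 e' L -> g K = g L -> K = L.
  exact: (tar_map_inj (proj2 iso)).
have VvJ : rvert_pred TAR 1 e' J by apply: fV.
have gJ : g J = [set v] by apply: fK.
apply: (@square_in_triangle _ e v (g (flip J x)) (g (flip J y)) (g (flip (flip J x) y)));
  rewrite -?gJ ?gA ?gV ?adj_flip //.
- by apply/eqP=> /(gI _ _ Vx Vy)/flip_inj E; rewrite E eqxx in yx.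
- by rewrite flipC adj_flip.
apply/eqP=> /(gI _ _ Vxy VvJ)/setP/(_ x).
by rewrite !in_flip eqxx xJ eq_sym (negPf yx).
Qed.

(** The image [[set x; y]] has only [[set x]] and [[set y]] as neighbours: a larger one would put
    [x] in a triangle and make [g [set x]] a singleton, but it is a pair. So [v] has degree 2 in the
    complement. *)
Lemma nonsingleton_nbrs (T T' : finType) (e : rel T) (e' : rel T') f g v :
  simple_graph e -> simple_graph e' -> tar_iso 1 e e' f g ->
  (forall x, f [set v] <> [set x]) ->
  exists a b, [/\ a != b, v != a, v != b,
    forall w, v != w -> ~~ e v w = (w == a) || (w == b)
    & forall w, v != w -> ~~ e v w -> exists x, f [set v; w] = [set x]].
Proof.
move=> se se' iso nfv; have [x [y [xy fv]]] := nonsingleton_pair se iso nfv.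
have [fM [gV gK gA]] := iso; have [fV fK fA] := fM.
have V1 : rvert_pred TAR 1 e [set v] by apply: valid_set1.
have V1' u : rvert_pred TAR 1 e' [set u] by apply: valid_set1.
have Ax u : u \in [set x; y] -> adj [set v] (g [set u]).
  rewrite -[in adj _](fK _ V1) gA ?fV // fv adj_sym !inE.
  by case/orP=> /eqP->; [|rewrite setUC]; rewrite adj_set1_set2 // eq_sym.
have [a va ga] := adj_set1 (gV _ (V1' x)) (Ax x (set21 _ _)).
have [b vb gb] := adj_set1 (gV _ (V1' y)) (Ax y (set22 _ _)).
have nbr w : v != w -> ~~ e v w -> f [set v; w] = [set x] \/ f [set v; w] = [set y].
  move=> vw nvw; have V2 : rvert_pred TAR 1 e [set v; w] by rewrite valid_set2.
  have : adj [set x; y] (f [set v; w]) by rewrite -fv fA // adj_set1_set2.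
  case/(adj_set2 xy (fV _ V2)) => [||[tx _]]; [by left|by right|].
  have [u] := triangle_singleton se' (tar_iso_sym iso) tx.
  by rewrite ga => /esym /(set1_neq2 va).
exists a, b; split=> // [|w vw|w vw /(nbr w vw)[]->]; first last.
- by exists y.
- by exists x.
- apply/idP/idP => [nvw|/orP[]/eqP->]; last first.
  + by rewrite -valid_set2 // -gb gV.
  + by rewrite -valid_set2 // -ga gV.
  have V2 : rvert_pred TAR 1 e [set v; w] by rewrite valid_set2.
  have := fK _ V2; case: (nbr w vw nvw) => ->; rewrite ?ga ?gb => /esym/(set2_injr vw)->.
    by rewrite eqxx.
  by rewrite eqxx orbT.
apply/eqP=> E; move: (gK _ (V1' x)); rewrite ga E -gb gK // => /set1_inj E'.
by rewrite E' eqxx in xy.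
Qed.

(* On the vertices sent to non-singletons the complement of [e] is a union of
   cycles and [f] swaps the vertices and edges of these; following an
   orientation, each such vertex is represented by its outgoing edge. *)
Lemma tar1_embeds (T T' : finType) (e : rel T) (e' : rel T') f g :
  simple_graph e -> simple_graph e' -> tar_iso 1 e e' f g -> embeds e e'.
Proof.
move=> se se' iso; have [fM [gV gK gA]] := iso; have [fV fK fA] := fM.
have V1 v : rvert_pred TAR 1 e [set v] by apply: valid_set1.
have V1' v : rvert_pred TAR 1 e' [set v] by apply: valid_set1.
have eC : symmetric e := proj2 se.
pose S v := ~~ [exists x, f [set v] == [set x]].
have SP v : S v -> forall x, f [set v] <> [set x].
  by move=> /existsPn H x /eqP; apply/negP.
have SN v : ~~ S v -> exists x, f [set v] = [set x].
  by rewrite negbK => /existsP[x /eqP]; exists x.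
have Sstep v w : v != w -> ~~ e v w -> S v -> S w.
  rewrite eq_sym eC => wv nwv Sv; case: (boolP (S w)) => // /SN[x fw].
  by have [y /(SP _ Sv)] := singleton_step se se' iso fw wv nwv.
(* The complement of [e] restricted to [S], a union of its components by [Sstep]. *)
pose r u v := [&& S u, v != u & ~~ e u v].
have rsym : symmetric r.
  by move=> u v; apply/idP/idP=> /and3P[Su vu nuv]; rewrite /r eq_sym vu eC nuv !andbT;
    apply: (Sstep _ _ _ nuv Su); rewrite eq_sym.
have [||u v|A [Ar AN Aex Aout Ain]] := @orient_2regular _ r => //.
- by move=> u; rewrite /r eqxx andbF.
- rewrite rsym => /and3P[Sv uv nvu].
  have [a [b [ab va vb Hv _]]] := nonsingleton_nbrs se se' iso (SP _ Sv).
  have rv z : r v z = (z == a) || (z == b).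
    rewrite /r Sv /=; case: (eqVneq z v) => [->|zv]; last by rewrite Hv // eq_sym.
    by rewrite (negPf va) (negPf vb).
  have : r v u by rewrite /r Sv uv.
  rewrite rv => /orP[]/eqP->.
    by exists b; first by rewrite eq_sym.
  by exists a => // z; rewrite rv orbC.
(* The default [[set v]] is taken exactly outside [S], where no arc leaves [v]. *)
pose rep v := if [pick z | A v z] is Some z then [set v; z] else [set v].
have repP v : (exists z, [/\ S v, A v z, v != z, ~~ e v z & rep v = [set v; z]])
    \/ (~~ S v /\ rep v = [set v]).
  rewrite /rep; case: pickP => [z Avz|nA].
    left; exists z; have /and3P[Sv zv nvz] := Ar _ _ Avz.
    by rewrite eq_sym.
  right; split=> //; apply/negP=> Sv.
  have [a [b [ab va vb Hv _]]] := nonsingleton_nbrs se se' iso (SP _ Sv).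
  have rva : r v a by rewrite /r Sv eq_sym va Hv // eqxx.
  by have [z] := Aex _ _ rva; rewrite nA.
have Vrep v : rvert_pred TAR 1 e (rep v).
  by case: (repP v) => [[z [_ _ _ nvz ->]]|[_ ->]]; rewrite ?valid_set2.
have repI : injective rep.
  move=> v w; case: (repP v) => [[z [Sv Avz vz nvz ->]]|[Sv ->]];
  case: (repP w) => [[y [Sw Awy wy nwy ->]]|[Sw ->]].
  - move=> E; have := set21 v z; rewrite E => /set2P[//|vy].
    have := set21 w y; rewrite -E => /set2P[//|wz].
    rewrite -wz in Avz; rewrite -vy in Awy.
    by have := AN _ _ (Ar _ _ Avz); rewrite Avz Awy.
  - by move=> /esym/(set1_neq2 vz).
  - by move=> /(set1_neq2 wy).
  - exact: set1_inj.
have /fin_all_exists[h hP] : forall v, exists x, f (rep v) = [set x].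
  move=> v; case: (repP v) => [[z [Sv _ vz nvz ->]]|[Sv ->]]; last exact: SN.
  by have [a [b [_ _ _ _]]] := nonsingleton_nbrs se se' iso (SP _ Sv); apply.
have hI : injective h.
  by move=> v w E; apply: repI; apply: (tar_map_inj fM) => //; rewrite !hP E.
(* Since [f] sends representatives to singletons, non-adjacency in [e'] amounts to a common
   neighbour of the representatives. *)
pose common v w := exists K, [/\ rvert_pred TAR 1 e K, adj (rep v) K & adj (rep w) K].
have common' v w : v != w -> ~~ e' (h v) (h w) <-> common v w.
  move=> vw; have hvw : h v != h w by rewrite (inj_eq hI).
  split=> [ne|[K [VK vK wK]]].
    have V2 : rvert_pred TAR 1 e' [set h v; h w] by rewrite valid_set2.
    exists (g [set h v; h w]); rewrite gV // -(fK _ (Vrep v)) -(fK _ (Vrep w)).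
    rewrite !gA ?fV // !hP adj_set1_set2 // setUC adj_set1_set2 //.
    by rewrite eq_sym.
  have := fV _ VK; rewrite (@adj_singletonsP _ e' (h v) (h w) (f K)) ?fV //.
  - by rewrite valid_set2.
  - by rewrite -hP fA.
  - by rewrite -hP fA.
have pair_nbr v z K : S v -> A v z -> rvert_pred TAR 1 e K -> adj [set v; z] K ->
    K = [set v] \/ K = [set z].
  move=> Sv Avz VK; have /and3P[_ zv _] := Ar _ _ Avz.
  have vz : v != z by rewrite eq_sym.
  case/(adj_set2 vz VK) => [||[tv _]]; [by left|by right|].
  by have [x /(SP _ Sv)] := triangle_singleton se iso tv.
(* Parity: neighbours of the pair [rep v] are singletons, those of the singleton [rep w] have even
   size. *)
have mixed v w : S v -> ~~ S w -> ~ common v w.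
  move=> Sv Sw; case: (repP v) => [[z [_ Avz _ _ E]]|[]]; last by rewrite Sv.
  case: (repP w) => [[y [Sw' _ _ _ _]]|[_ E']]; first by rewrite Sw' in Sw.
  move=> [K [VK]]; rewrite E E' => vK /adj_card.
  by case: (pair_nbr _ _ _ Sv Avz VK vK) => ->; rewrite !cards1.
(* Within [S], a common neighbour is a shared endpoint of two arcs. The arcs have different tails
   and cannot share a head, so the head of one is the tail of the other. *)
have commonE v w : v != w -> common v w <-> ~~ e v w.
  move=> vw; case: (boolP (S v)) => Sv; case: (boolP (S w)) => Sw.
  - case: (repP v) => [[z [_ Avz vz nvz Ev]]|[]]; last by rewrite Sv.
    case: (repP w) => [[y [_ Awy wy nwy Ew]]|[]]; last by rewrite Sw.
    split=> [[K [VK]]|nvw].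
      rewrite Ev Ew => vK wK.
      case: (pair_nbr _ _ _ Sv Avz VK vK) => E1;
      case: (pair_nbr _ _ _ Sw Awy VK wK) => E2;
      have /set1_inj E := etrans (esym E1) E2.
      + by rewrite E eqxx in vw.
      + by rewrite E eC.
      + by rewrite -E.
      + by rewrite E in Avz; rewrite (Ain _ _ _ Avz Awy) eqxx in vw.
    have rvw : r v w by rewrite /r Sv eq_sym vw.
    case: (boolP (A v w)) => [Avw|nAvw]; [exists [set w]|exists [set v]]; split=> //.
    + by rewrite Ev (Aout _ _ _ Avz Avw) adj_sym setUC adj_set1_set2 // eq_sym.
    + by rewrite Ew adj_sym adj_set1_set2.
    + by rewrite Ev adj_sym adj_set1_set2.
    have Awv : A w v by rewrite AN // rsym.
    by rewrite Ew (Aout _ _ _ Awy Awv) adj_sym setUC adj_set1_set2.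
  - split=> [/(mixed _ _ Sv Sw)//|nvw]; by rewrite (Sstep _ _ vw nvw Sv) in Sw.
  - split=> [[K [VK vK wK]]|nvw]; first by case: (mixed w v Sw Sv); exists K.
    by rewrite (Sstep w v) // 1?eq_sym // 1?eC in Sv.
  case: (repP v) => [[z [Sv' _ _ _ _]]|[_ Ev]]; first by rewrite Sv' in Sv.
  case: (repP w) => [[y [Sw' _ _ _ _]]|[_ Ew]]; first by rewrite Sw' in Sw.
  split=> [[K [VK]]|nvw].
    rewrite Ev Ew => vK wK; rewrite -valid_set2 //.
    by rewrite -(adj_singletonsP vw VK vK wK).
  exists [set v; w]; rewrite valid_set2 // Ev Ew adj_set1_set2 // setUC.
  by rewrite adj_set1_set2 // eq_sym.
exists h; split=> // v w; case: (eqVneq v w) => [->|vw].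
  by rewrite (proj1 se) (proj1 se').
apply: negb_inj; apply/idP/idP => [/(common' _ _ vw)/(commonE _ _ vw)//|].
by move/(commonE _ _ vw)/(common' _ _ vw).
Qed.

(** * Token Sliding with [k = 1], and conclusion of the positive part *)

(** The map sending [x] to [[set x]] identifies a graph with its own reconfiguration graph. *)
Lemma ts1_iso (T T' : finType) (e : rel T) (e' : rel T') :
  simple_graph e -> simple_graph e' ->
  graph_iso (reconf_graph TS 1 e) (reconf_graph TS 1 e') -> graph_iso e e'.
Proof.
move=> se se' [F [[G FK GK] FE]].
have single (U : finType) (d : rel U) : simple_graph d ->
    exists2 s : U -> rvert TS 1 d, bijective s
      & forall x y, reconf_graph TS 1 d (s x) (s y) = d x y.
  move=> sd; have V x : rvert_pred TS 1 d [set x].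
    by rewrite /rvert_pred independent1 // cards1.
  pose s x : rvert TS 1 d := exist _ [set x] (V x).
  have sI : injective s by move=> x y /(congr1 val)/set1_inj.
  exists s.
    have /fin_all_exists[t tK] : forall u, exists x, s x = u.
      move=> u; have /andP[_ /cards1P[x ux]] := valP u.
      by exists x; apply: val_inj.
    by exists t => // x; apply: sI.
  move=> x y; apply/existsP/idP => [[u /existsP[v /and3P[/eqP xu /eqP yv duv]]]|dxy].
    have /setD1P[_ /set1P ux] : u \in [set x] :\ y by rewrite [_ :\ _]xu set11.
    have /setD1P[_ /set1P vy] : v \in [set y] :\ x by rewrite [_ :\ _]yv set11.
    by rewrite -ux -vy.
  have xy : x != y by apply: contraTneq dxy => ->; rewrite (proj1 sd).
  exists x; apply/existsP; exists y; rewrite dxy andbT /=.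
  by apply/andP; split; apply/eqP/setDidPl; rewrite disjoints1 inE // eq_sym.
have [s [t sK tK] sE] := single _ _ se; have [s' [t' sK' tK'] sE'] := single _ _ se'.
exists (fun x => t' (F (s x))); split.
  by exists (fun y => t (G (s' y))) => x; rewrite ?tK' ?tK ?FK ?GK ?sK ?sK'.
by move=> x y; rewrite -sE' !tK' FE sE.
Qed.

Lemma tar_le1_iso k (T T' : finType) (e : rel T) (e' : rel T') :
  k <= 1 -> simple_graph e -> simple_graph e' ->
  graph_iso (reconf_graph TAR k e) (reconf_graph TAR k e') -> graph_iso e e'.
Proof.
move=> k1 se se' /graph_iso_tar[f [g iso]].
have [E E'] : embeds e e' /\ embeds e' e.
  have iso' := tar_iso_sym iso.
  case: k k1 iso iso' => [|[|//]] _ iso iso'.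
    by split; [apply: tar0_embeds iso|apply: tar0_embeds iso'].
  by split; [apply: tar1_embeds iso|apply: tar1_embeds iso'].
by apply: embeds_iso E _; case: E' => h [hI _]; apply: leq_card hI.
Qed.

(** * Non-isomorphic graphs with isomorphic reconfiguration graphs *)

Definition complete_rel (T : finType) : rel T := [rel x y | x != y].

Lemma simple_complete (T : finType) : simple_graph (@complete_rel T).
Proof. by split=> [x|x y]; rewrite /complete_rel /= ?eqxx // eq_sym. Qed.

Lemma independent_complete (T : finType) (I : {set T}) :
  independent (@complete_rel T) I -> #|I| <= 1.
Proof.
move/independentP=> H; apply/card_le1_eqP=> x y xI yI.
by have /negPn/eqP := H x y xI yI.
Qed.

Lemma empty_graph_iso (V V' : finType) (r : rel V) (r' : rel V') :
  (V -> False) -> (V' -> False) -> graph_iso r r'.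
Proof.
move=> nV nV'; exists (fun v => False_rect V' (nV v)); split=> [|v]; last by case: (nV v).
by exists (fun v => False_rect V (nV' v)) => v; [case: (nV v)|case: (nV' v)].
Qed.

Lemma complete_no_rvert (T : finType) R k :
  1 < k -> rvert R k (@complete_rel T) -> False.
Proof.
move=> k1 [I /andP[/independent_complete I1]]; have Ik := leq_ltn_trans I1 k1.
by case: R; rewrite ?(ltn_eqF Ik) // leqNgt Ik.
Qed.

Lemma not_iso_card (V V' : finType) (r : rel V) (r' : rel V') :
  #|V| <> #|V'| -> ~ graph_iso r r'.
Proof. by move=> ne [f [/bij_eq_card]]. Qed.

Lemma rvert0_iso R (T T' : finType) (e : rel T) (e' : rel T') :
  R <> TAR -> graph_iso (reconf_graph R 0 e) (reconf_graph R 0 e').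
Proof.
move=> RTAR.
have V0 (U : finType) (d : rel U) : rvert_pred R 0 d set0.
  apply/andP; split; first by apply/independentP=> x y; rewrite inE.
  by case: R RTAR => //; rewrite cards0.
have val0 (U : finType) (d : rel U) (u : rvert R 0 d) : val u = set0.
  by case/andP: (valP u) => _; case: R RTAR u {V0} => // _ u /=; rewrite cards_eq0 => /eqP.
have adj0 (U : finType) (d : rel U) (u v : rvert R 0 d) : reconf_graph R 0 d u v = false.
  rewrite /reconf_graph !val0; case: R RTAR {V0 val0 u v} => //= _; first by rewrite setD0 cards0.
  apply/existsP=> -[x /existsP[y /and3P[/eqP/setP/(_ x)]]].
  by rewrite !inE eqxx.
exists (fun=> exist _ set0 (V0 T' e')); split; last by move=> x y; rewrite !adj0.
by exists (fun=> exist _ set0 (V0 T e)) => u; apply: val_inj; rewrite val0.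
Qed.

(** Jumping between singletons ignores edges, so the identity on underlying sets is an
    isomorphism. *)
Lemma tj1_iso (T : finType) (e e' : rel T) :
  simple_graph e -> simple_graph e' ->
  graph_iso (reconf_graph TJ 1 e) (reconf_graph TJ 1 e').
Proof.
move=> se se'.
have V (d d' : rel T) (u : rvert TJ 1 d) : simple_graph d' -> rvert_pred TJ 1 d' (val u).
  move=> sd'; have /andP[_ /cards1P[x E]] := valP u.
  by rewrite E /rvert_pred independent1 // cards1.
exists (fun u => exist _ (val u) (V e e' u se')); split=> //.
by exists (fun u => exist _ (val u) (V e' e u se)) => u; apply: val_inj.
Qed.

Theorem theorem1p8 (R : rule) (k : nat) :
  (((R = TS /\ k = 1) \/ (R = TAR /\ k <= 1)) ->
     forall (T T' : finType) (e : rel T) (e' : rel T'),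
       simple_graph e -> simple_graph e' ->
       graph_iso (reconf_graph R k e) (reconf_graph R k e') -> graph_iso e e')
  /\
  (~ ((R = TS /\ k = 1) \/ (R = TAR /\ k <= 1)) ->
     exists (T T' : finType) (e : rel T) (e' : rel T'),
       [/\ simple_graph e, simple_graph e',
           graph_iso (reconf_graph R k e) (reconf_graph R k e') & ~ graph_iso e e']).
Proof.
split=> [[[-> ->]|[-> k1]] T T' e e' se se'|other]; [exact: ts1_iso|exact: tar_le1_iso|].
(* Complete graphs on one and two vertices serve for [k = 0] and for [k] at least 2. *)
have K12 : graph_iso (reconf_graph R k (@complete_rel unit))
    (reconf_graph R k (@complete_rel bool)) ->
    exists (T T' : finType) (e : rel T) (e' : rel T'),
      [/\ simple_graph e, simple_graph e',
        graph_iso (reconf_graph R k e) (reconf_graph R k e') & ~ graph_iso e e'].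
  move=> iso; exists unit, bool, (@complete_rel _), (@complete_rel _).
  by split=> //; try exact: simple_complete; apply: not_iso_card; rewrite card_unit card_bool.
case: (ltnP 1 k) => [k1|k1].
  by apply: K12; apply: empty_graph_iso; apply: complete_no_rvert.
have RTAR : R <> TAR by move=> E; apply: other; right.
case: k k1 other K12 => [|[|//]] _ other K12; first by apply: K12; apply: rvert0_iso.
have -> : R = TJ by case: R RTAR other {K12} => // _ []; left.
have sE : simple_graph [rel x y : bool | false] by [].
(* For Token Jumping with [k = 1] the two graphs need equally many vertices: an edge and its
   complement. *)
exists bool, bool, (@complete_rel _), [rel x y | false]; split=> //.
- exact: simple_complete.
- by apply: tj1_iso => //; apply: simple_complete.
by move=> [h [_ /(_ true false)]].
Qed.
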